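(* There are absolute positive constants $c''_0$ and $c'_1$ such that the following holds. Let $\mathcal F$ be a class of $\{0,1\}$-valued functions on $\mathcal X$ with VC-dimension $d$, $2\le d<\infty$, and let $u,m$ be integers with $u\ge m\ge d$; put $n=u+m$. Let $(\mathbf x_i,y_i)_{i=1}^n$ be a fixed full sample with $\mathbf x_i\in\mathcal X$, $y_i\in\{0,1\}$, and put $\ell_f(i)=(f(\mathbf x_i)-y_i)^2=\mathbf 1\{f(\mathbf x_i)\ne y_i\}$. Assume that the full sample is realizable: there exists $f^*\in\mathcal F$ such that $f^*(\mathbf x_i)=y_i$ for every $i\in[n]$. Let $Z$ be uniform over the $u$-element subsets of $[n]$, and for each split let $\hat f_m$ be any minimizer over $f\in\mathcal F$ of the training loss $\mathcal L_m(\ell_f)$. Then, for every $x>0$, with probability at least $1-\exp(-x)$ over $Z$, $$\mathcal L_u(\ell_{\hat f_m})\le c''_0\,\frac{d\log(me/d)}{m}+c'_1\,\frac{x}{m}.$$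
   Context: $[n]=\{1,\dots,n\}$, $\mathcal X\subseteq\mathbb R^{d'}$ for some $d'\in\mathbb N$ (repeated feature values $\mathbf x_i$ are allowed). The training index set is $\bar Z=[n]\setminus Z$ (size $m$) and the test index set is $Z$ (size $u$). For $h:[n]\to\mathbb R$: $\mathcal L_m(h)=m^{-1}\sum_{i\in\bar Z}h(i)$ and $\mathcal L_u(h)=u^{-1}\sum_{i\in Z}h(i)$. *)

(* Defs.v *)
From mathcomp Require Import all_boot all_order all_algebra finmap.
From mathcomp Require Import classical_sets reals sequences exp.

Set Implicit Arguments.
Unset Strict Implicit.
Unset Printing Implicit Defensive.

Import Order.TTheory GRing.Theory Num.Theory.
Local Open Scope ring_scope.

Definition shatters (T : choiceType) (F : set (T -> bool)) (S : {fset T}) : Prop :=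
  forall A : {fset T}, (A `<=` S)%fset ->
    exists2 f, F f & forall x, x \in S -> f x = (x \in A).

(* No [d] satisfies this when the VC-dimension of [F] is infinite, nor when
   [F] is empty (then not even the empty set is shattered). *)
Definition has_VCdim (T : choiceType) (F : set (T -> bool)) (d : nat) : Prop :=
  (exists2 S : {fset T}, shatters F S & #|` S| = d) /\
  (forall S : {fset T}, shatters F S -> (#|` S| <= d)%N).

(* [{0,1}] is [bool], embedded in [R] by [(_)%:R]. *)
Definition sq_loss (R : realType) (T : Type) (n : nat) (xs : 'I_n -> T)
    (ys : 'I_n -> bool) (f : T -> bool) (i : 'I_n) : R :=
  ((f (xs i))%:R - (ys i)%:R) ^+ 2.

(* [Z] is the set of test indices, its complement the set of training indices;
   the normalizations are the sample means when [#|Z| = u]. *)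
Definition train_mean (R : realType) (u m : nat) (Z : {set 'I_(u + m)})
    (h : 'I_(u + m) -> R) : R :=
  m%:R^-1 * \sum_(i in ~: Z) h i.

Definition test_mean (R : realType) (u m : nat) (Z : {set 'I_(u + m)})
    (h : 'I_(u + m) -> R) : R :=
  u%:R^-1 * \sum_(i in Z) h i.

Definition splits (u m : nat) : {set {set 'I_(u + m)}} :=
  [set Z : {set 'I_(u + m)} | #|Z| == u].

Definition unif_prob (R : realType) (T : finType) (A : {set T}) (E : pred T) : R :=
  #|[set t in A | E t]|%:R / #|A|%:R.

Definition is_minimizer (R : realType) (T : Type) (F : set T) (g : T -> R)
    (f : T) : Prop :=
  F f /\ forall f', F f' -> g f <= g f'.

(* Main.v *)
Require Import Defs.
From mathcomp Require Import all_boot all_order all_algebra finmap.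
From mathcomp Require Import boolp classical_sets reals sequences exp.
From mathcomp Require Import zify ring lra.

(* Call a training set [T] bad when some error set [E] of the class misses [T]
   and has more than [eps * u] elements. Extend [T] to a random set [W] of size
   [2 * m] (a ghost sample; this needs [m <= u]). The mean of [#|E :&: W|] is
   [#|E| * m / u], so by Jensen the mean of [expR (#|E :&: W| / 2)] is at least
   [expR (eps * m / 2)] for a bad [T]. Conversely, fix [W] and let [T] be
   uniform among its subsets of size [m]: a fixed subset [E'] of [W] misses [T]
   with probability at most [2 ^- #|E'|], which is at most
   [expR (- #|E'| / 2)], so each trace on [W] contributes at most 1 and
   Sauer-Shelah bounds their number by [(2 * e * m / d) ^+ d], a bound that does
   not depend on [u]. Hence the probability that [T] is bad is at most
   [(2 * e * m / d) ^+ d * expR (- eps * m / 2)]. *)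

Import Order.TTheory GRing.Theory Num.Theory.
Local Open Scope ring_scope.

Section FiniteSets.

(* [classical_sets] hides the homonymous lemmas on finite sets. *)
Import mathcomp.boot.fintype mathcomp.boot.finset.

(** * Shattering by finite families of sets and the Sauer-Shelah bound *)

Definition fam_shatters {I : finType} (A : {set {set I}}) (S : {set I}) : bool :=
  [forall (B : {set I} | B \subset S), [exists E in A, E :&: S == B]].

Lemma fam_shattersP {I : finType} {A : {set {set I}}} {S : {set I}} :
  reflect (forall B : {set I}, B \subset S -> exists2 E, E \in A & E :&: S = B)
          (fam_shatters A S).
Proof.
apply: (iffP forall_inP) => H B /H.
  by case/exists_inP => E EA /eqP; exists E.
by case=> E EA EB; apply/exists_inP; exists E => //; apply/eqP.
Qed.

Lemma sub_fam_shatters {I : finType} {A A' : {set {set I}}} {S : {set I}} :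
  A \subset A' -> fam_shatters A S -> fam_shatters A' S.
Proof.
move=> /subsetP sAA' /fam_shattersP H; apply/fam_shattersP => B /H [E EA EB].
by exists E => //; apply: sAA'.
Qed.

(* Pajor's form of the Sauer-Shelah lemma. *)
Lemma leq_card_shattered {I : finType} (A : {set {set I}}) :
  (#|A| <= #|[set S | fam_shatters A S]|)%N.
Proof.
have [n] := ubnP #|A|; elim: n A => // n IHn A /ltnSE leAn.
have [A1|/card_gt1P[E [E' [EA E'A neqE]]]] := leqP #|A| 1.
  have [->|[E EA]] := set_0Vmem A; first by rewrite cards0.
  apply: leq_trans A1 _; rewrite card_gt0; apply/set0Pn; exists set0.
  rewrite inE; apply/fam_shattersP => B; rewrite subset0 => /eqP ->.
  by exists E => //; rewrite setI0.
have [x xE] : exists x, (x \in E) != (x \in E').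
  apply/existsP; apply: contraNT neqE; rewrite negb_exists => /forallP H.
  by apply/eqP/setP => x; apply/eqP; rewrite -[_ == _]negbK H.
(* Split [A] by membership of [x]. The choice of [x] puts [E] and [E'] in different halves, so both
   halves are smaller than [A] and the induction hypothesis applies to them. *)
pose C (b : bool) := [set D in A | (x \in D) == b].
have subC b : C b \subset A by apply/subsetP => D; rewrite inE => /andP[].
have cardA : #|A| = (#|C false| + #|C true|)%N.
  rewrite -(cardsID [set D : {set I} | x \in D] A) addnC; congr (_ + _)%N;
    by apply: eq_card => D; rewrite !inE ?eqb_id ?eqbF_neg // andbC.
have ltC b : (#|C b| < #|A|)%N.
  apply: proper_card; rewrite properE subC; apply/subsetPn.
  have [xEb|xEb] := eqVneq (x \in E) b.
    by exists E' => //; rewrite inE E'A -xEb eq_sym.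
  by exists E => //; rewrite inE EA.
pose Sh b := [set S | fam_shatters (C b) S].
have leSh b : (#|C b| <= #|Sh b|)%N by apply: IHn; apply: leq_trans (ltC b) _.
have xSh b S : S \in Sh b -> x \notin S.
  rewrite inE => /fam_shattersP H; apply/negP => xS.
  (* All members of [C b] agree at [x]; the trace tried here disagrees with them at [x]. *)
  have [D DC DS] := H (if b then set0 else [set x]) ltac:(by case: (b); rewrite ?sub0set ?sub1set).
  move/setP/(_ x): DS; move: DC; rewrite !inE xS => /andP[_ /eqP ->].
  by case: (b); rewrite !inE ?eqxx.
(* If both halves shatter [S], then [A] shatters [x |: S] as well as [S]. These extra sets contain
   [x], unlike those of [Sh b], and make up for the overlap of [Sh false] and [Sh true]. *)
pose Sh2 := [set x |: S | S in Sh false :&: Sh true].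
have cardSh2 : #|Sh2| = #|Sh false :&: Sh true|.
  apply: card_in_imset => S S'; rewrite !in_setI => /andP[/xSh xS _] /andP[/xSh xS' _] eqS.
  by rewrite -(setU1K xS) eqS setU1K.
have dis : Sh2 :&: (Sh false :|: Sh true) = set0.
  apply/eqP; rewrite -subset0; apply/subsetP => _ /setIP[/imsetP[S _ ->]].
  by rewrite in_setU => /orP[] /xSh; rewrite setU11.
rewrite cardA; apply: leq_trans (leq_add (leSh false) (leSh true)) _.
rewrite -cardsUI -cardSh2 addnC -cardsUI dis cards0 addn0.
apply/subset_leq_card/subsetP => S; rewrite in_setU => /orP[|]; last first.
  by rewrite in_setU !inE => /orP[]; apply: sub_fam_shatters.
case/imsetP => {}S /setIP[S0 S1] ->; rewrite inE; apply/fam_shattersP => B sB.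
have S_b b : S \in Sh b by case: b.
(* The half is chosen to give the right value at [x]; shattering of [S] by that half gives the rest
   of [B]. *)
have := S_b (x \in B); rewrite inE => /fam_shattersP/(_ (B :&: S)) [|D].
  exact: subsetIr.
rewrite inE => /andP[DA /eqP xD] /setP DB; exists D => //; apply/setP => y.
rewrite !inE; have [->|neqy] := eqVneq y x; first by rewrite xD andbT.
have := DB y; rewrite !inE /= => ->.
have [yB|] := boolP (y \in B) => //.
by have := subsetP sB y yB; rewrite !inE (negPf neqy).
Qed.

(** A set shattered by the traces on [W] lies in [W] and is shattered by [A] itself, so Pajor's
    bound leaves only subsets of [W] of size at most [d]. *)
Lemma leq_card_traces {I : finType} (A : {set {set I}}) (d : nat) (W : {set I}) :
  (forall S, fam_shatters A S -> (#|S| <= d)%N) ->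
  (#|[set E :&: W | E in A]| <= \sum_(i < d.+1) 'C(#|W|, i))%N.
Proof.
move=> Ad; apply: leq_trans (leq_card_shattered _) _.
have -> : (\sum_(i < d.+1) 'C(#|W|, i) =
  #|[set S : {set I} | (S \subset W) && (#|S| <= d)]|)%N.
  rewrite -[RHS]sum1_card (partition_big (fun S : {set I} => inord #|S| : 'I_d.+1) xpredT) //=.
  apply: eq_bigr => i _; rewrite -cards_draws -[LHS]sum1_card.
  apply: eq_bigl => S; rewrite !inE -andbA; congr (_ && _).
  have [leSd|ltdS] /= := leqP #|S| d; first by rewrite -val_eqE /= inordK.
  by apply/negbTE; apply: contraTneq ltdS => ->; rewrite -leqNgt -ltnS.
apply/subset_leq_card/subsetP => S; rewrite !inE => /fam_shattersP H.
apply/andP; split.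
  by have [_ /imsetP[E EA ->] /setIidPr] := H S (subxx S); rewrite subsetI => /andP[].
apply: Ad; apply/fam_shattersP => B sB.
have sSW : S \subset W.
  by have [_ /imsetP[E EA ->] /setIidPr] := H S (subxx S); rewrite subsetI => /andP[].
have [_ /imsetP[E EA ->] <-] := H B sB.
by exists E => //; rewrite -setIA (setIidPr sSW).
Qed.

(** With [r = d / N <= 1], each ['C(N, i) * r ^+ d] is at most ['C(N, i) * r ^+ i]. Summing gives at
    most [(1 + r) ^+ N], hence at most [expR (r * N) = expR d]. *)
Lemma sum_bin_le (R : realType) (N d : nat) : (0 < d)%N -> (d <= N)%N ->
  (\sum_(i < d.+1) 'C(N, i))%:R <= (expR 1 * (N%:R / d%:R)) ^+ d :> R.
Proof.
move=> d0 dN; have N0 : (0 < N)%N by apply: leq_trans dN.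
pose r : R := d%:R / N%:R.
have r0 : 0 < r by rewrite divr_gt0 ?ltr0n.
have r1 : r <= 1 by rewrite ler_pdivrMr ?ltr0n // mul1r ler_nat.
have -> : N%:R / d%:R = r^-1 :> R by rewrite invf_div.
rewrite exprMn exprVn ler_pdivlMr ?exprn_gt0 // -expRM_natl mulr1.
have -> : expR d%:R = expR r ^+ N.
  by rewrite -expRM_natl mulrC divfK // pnatr_eq0 -lt0n.
apply: (@le_trans _ _ ((1 + r) ^+ N)); last first.
  by apply: lerXn2r (expR_ge1Dx _); rewrite nnegrE ?expR_ge0 ?addr_ge0 ?ler01 ?ltW.
rewrite exprDn natr_sum mulr_suml.
rewrite (big_ord_widen N.+1 (fun i => 'C(N, i)%:R * r ^+ d)) //.
rewrite big_mkcond /=; apply: ler_sum => i _.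
rewrite expr1n mul1r; case: ifP => [id|_]; last by rewrite mulrn_wge0 ?exprn_ge0 ?ltW.
rewrite -[leRHS]mulr_natl ler_wpM2l ?ler0n //.
by rewrite ler_wiXn2l // ltW.
Qed.

(** * Counting subsets and supersets, with exponential moments *)

Lemma card_supersets {I : finType} (T : {set I}) (k : nat) : (k <= #|I|)%N ->
  #|[set W : {set I} | (T \subset W) && (#|W| == k)]| = 'C(#|~: T|, #|I| - k).
Proof.
move=> kI; rewrite -cards_draws -(card_imset _ (can_inj (@setCK I))).
apply: eq_card => V; apply/imsetP/idP => [[W]|].
  rewrite !inE => /andP[sTW /eqP cW] ->.
  by rewrite setCS sTW; apply/eqP; have := cardsC W; lia.
rewrite !inE => /andP[sVT /eqP cV]; exists (~: V); last by rewrite setCK.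
by rewrite inE -setCS setCK sVT; apply/eqP; have := cardsC V; lia.
Qed.

(** Lowering [M <= 2 * m] by one at least halves ['C(M, m)], because
    [M * 'C(M.-1, m) = (M - m) * 'C(M, m)] and [2 * (M - m) <= M]. *)
Lemma bin_sub_exp2 (m N j : nat) : (0 < m)%N -> (N <= m.*2)%N ->
  ('C(N - j, m) * 2 ^ j <= 'C(N, m))%N.
Proof.
move=> m0 Nm; elim: j => [|j IHj]; first by rewrite subn0 expn0 muln1.
apply: leq_trans IHj; rewrite expnS mulnA leq_mul2r subnS; apply/orP; right.
have : (N - j <= m.*2)%N by lia.
move: (N - j)%N => M Mm; have [->|M0] := posnP M; first by rewrite bin_small.
rewrite -(leq_pmul2l M0) mulnA mul_bin_down mulnAC leq_mul2r; apply/orP; right.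
by lia.
Qed.

Lemma expR_half_le (R : realType) (j : nat) : expR (j%:R / 2) <= (2 ^ j)%:R :> R.
Proof.
rewrite expRM_natl natrX; apply: lerXn2r; rewrite ?nnegrE ?expR_ge0 //.
(* The base case [expR (1 / 2) <= 2] is the inverse of [1 - 1 / 2 <= expR (- 1 / 2)]. *)
rewrite -[_^-1]opprK expRN -[leRHS]invrK lef_pV2 ?posrE ?expR_gt0 ?invr_gt0 //.
by apply: le_trans (expR_ge1Dx _); lra.
Qed.

(** The exponential lies above its tangent at the mean [a], and the linear terms sum to zero. *)
Lemma expR_jensen (R : realType) (J : finType) (P : pred J) (x : J -> R) (a : R) :
  \sum_(j | P j) x j = #|P|%:R * a ->
  #|P|%:R * expR a <= \sum_(j | P j) expR (x j).
Proof.
move=> xa; apply: (@le_trans _ _ (\sum_(j | P j) expR a * (1 + (x j - a)))).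
  rewrite -mulr_sumr !big_split /= sumrN xa !sumr_const.
  by rewrite -(mulr_natl a) subrr addr0 mulrC.
apply: ler_sum => j _; rewrite -[in leRHS](subrKC a (x j)) expRD.
by rewrite ler_wpM2l ?expR_ge0 ?expR_ge1Dx.
Qed.

(** Exchanging sums, each [i] in [E] lies in ['C(u.-1, u - k)] of the sets [W], and
    [u * 'C(u.-1, u - k) = k * 'C(u, u - k)]. Multiplying by [u] keeps the mean [#|E| * k / u] in
    [nat]. *)
Lemma sum_card_supersets {I : finType} (u m k : nat) (T E : {set I}) :
  #|I| = (u + m)%N -> #|T| = m -> (k <= u)%N -> [disjoint E & T] ->
  (u * \sum_(W : {set I} | (T \subset W) && (#|W| == m + k)) #|E :&: W| =
   #|E| * k * #|[set W : {set I} | (T \subset W) && (#|W| == m + k)]|)%N.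
Proof.
move=> cI cT ku dET.
have -> : (\sum_(W : {set I} | (T \subset W) && (#|W| == m + k)) #|E :&: W| =
   \sum_(i in E) 'C(u.-1, u - k))%N.
  transitivity (\sum_(W : {set I} | (T \subset W) && (#|W| == m + k))
                  \sum_(i in E | i \in W) 1)%N.
    by apply: eq_bigr => W _; rewrite sum1_card; apply: eq_card => i; rewrite !inE.
  rewrite (exchange_big_dep (fun i => i \in E)) /=; last by move=> W i _ /andP[].
  apply: eq_bigr => i iE.
  have iT : i \notin T by rewrite (disjointFr dET).
  have -> : 'C(u.-1, u - k) = 'C(#|~: (i |: T)|, #|I| - (m + k)).
    have := cardsC (i |: T); rewrite cardsU1 iT cI cT => cC.
    by congr 'C(_, _); lia.
  rewrite -card_supersets; last by lia.
  rewrite sum1dep_card; apply: eq_card => W; rewrite !inE.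
  rewrite subUset sub1set. by rewrite iE andbC andbA.
rewrite card_supersets; last by lia.
have -> : (#|I| - (m + k) = u - k)%N by lia.
have -> : #|~: T| = u by have := cardsC T; lia.
rewrite sum_nat_const mulnCA mul_bin_down subKn //.
by rewrite mulnA.
Qed.

Lemma expR_supersets (R : realType) (I : finType) (u m k : nat) (T E : {set I}) :
  #|I| = (u + m)%N -> #|T| = m -> (0 < u)%N -> (k <= u)%N -> [disjoint E & T] ->
  #|[set W : {set I} | (T \subset W) && (#|W| == m + k)%N]|%:R *
      expR (#|E|%:R * k%:R / u%:R / 2)
    <= \sum_(W : {set I} | (T \subset W) && (#|W| == m + k)%N)
         expR (#|E :&: W|%:R / 2) :> R.
Proof.
move=> cI cT u0 ku dET.
have -> : #|[set W : {set I} | (T \subset W) && (#|W| == m + k)%N]| =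
  #|(fun W : {set I} => (T \subset W) && (#|W| == m + k)%N) : pred _|.
  by apply: eq_card => W; rewrite inE.
apply: expR_jensen; rewrite -mulr_suml mulrA; congr (_ / 2).
have /(congr1 (fun x => x%:R : R)) := sum_card_supersets _ _ _ _ _ cI cT ku dET.
have -> : #|[set W : {set I} | (T \subset W) && (#|W| == m + k)%N]| =
  #|(fun W : {set I} => (T \subset W) && (#|W| == m + k)%N) : pred _|.
  by apply: eq_card => W; rewrite inE.
rewrite !natrM natr_sum => H; apply: (@mulfI _ u%:R); first by rewrite pnatr_eq0 -lt0n.
by rewrite H; field; rewrite pnatr_eq0 -lt0n.
Qed.

Lemma expR_subsets_le (R : realType) (I : finType) (m : nat) (W E : {set I}) :
  (0 < m)%N -> #|W| = (m + m)%N -> E \subset W ->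
  \sum_(T : {set I} | (T \subset W) && (#|T| == m))
     (if [disjoint E & T] then expR (#|E|%:R / 2) else 0)
  <= 'C(m + m, m)%:R :> R.
Proof.
move=> m0 cW sEW; rewrite -big_mkcondr /=.
have -> : \sum_(T : {set I} | ((T \subset W) && (#|T| == m)) && [disjoint E & T])
     expR (#|E|%:R / 2) = 'C(m + m - #|E|, m)%:R * expR (#|E|%:R / 2) :> R.
  rewrite sumr_const [RHS]mulr_natl; congr (_ *+ _).
  rewrite -cW -(cardsDS sEW) -cards_draws; apply: eq_card => T.
  by rewrite !inE /= subsetD disjoint_sym -!topredE /= andbAC.
apply: (@le_trans _ _ ('C(m + m - #|E|, m) * 2 ^ #|E|)%:R).
  by rewrite natrM ler_wpM2l ?expR_half_le.
by rewrite ler_nat bin_sub_exp2 // addnn.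
Qed.

(** * The ghost-sample bound on bad training sets *)

Lemma card_bad_training_sets (R : realType) (I : finType) (A : {set {set I}})
    (u m B : nat) (a : R) :
  #|I| = (u + m)%N -> (0 < m)%N -> (m <= u)%N ->
  (forall W : {set I}, #|W| = (m + m)%N -> (#|[set E :&: W | E in A]| <= B)%N) ->
  #|[set T : {set I} | (#|T| == m) &&
      [exists E in A, [disjoint E & T] && (a <= #|E|%:R * m%:R / u%:R / 2)]]|%:R
    * expR a <= B%:R * 'C(u + m, m)%:R.
Proof.
move=> cI m0 mu leB; set Bad := [set T | _].
have u0 : (0 < u)%N by apply: leq_trans mu.
pose N := 'C(u, u - m).
have cN (T : {set I}) : #|T| = m ->
    #|[set W : {set I} | (T \subset W) && (#|W| == m + m)%N]| = N.
  move=> cT; rewrite card_supersets; last by lia.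
  by congr 'C(_, _); have := cardsC T; lia.
have N0 : (0 < N)%N by rewrite bin_gt0 leq_subr.
pose tr (W : {set I}) := [set E :&: W | E in A].
(* The sum runs over distinct traces, so it has at most [B] terms; for a bad [T] one of them is the
   trace of a witness [E]. Summing [H] over pairs [T \subset W] in both orders compares the two
   bounds. *)
pose H (T W : {set I}) : R :=
  \sum_(E in tr W) if [disjoint E & T] then expR (#|E|%:R / 2) else 0.
have H0 T W : 0 <= H T W by apply: sumr_ge0 => E _; case: ifP; rewrite ?expR_ge0.
have lower T : T \in Bad ->
    N%:R * expR a <= \sum_(W : {set I} | (T \subset W) && (#|W| == m + m)%N) H T W.
  rewrite inE => /andP[/eqP cT /exists_inP[E EA /andP[dET aE]]].
  apply: (@le_trans _ _ (N%:R * expR (#|E|%:R * m%:R / u%:R / 2))).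
    by rewrite ler_wpM2l ?ler_expR.
  have := expR_supersets R _ _ _ _ _ _ cI cT u0 mu dET.
  rewrite (cN T cT) => /le_trans; apply.
  apply: ler_sum => W _; rewrite /H (bigD1 (E :&: W)) /=; last exact: imset_f.
  rewrite (disjointWl _ dET) ?subsetIl // lerDl.
  by apply: sumr_ge0 => E' _; case: ifP; rewrite ?expR_ge0.
have upper (W : {set I}) : #|W| = (m + m)%N ->
    \sum_(T : {set I} | (T \subset W) && (#|T| == m)) H T W
    <= B%:R * \sum_(T : {set I} | (T \subset W) && (#|T| == m)) 1.
  move=> cW.
  have -> : \sum_(T : {set I} | (T \subset W) && (#|T| == m)) 1 = 'C(m + m, m)%:R :> R.
    rewrite sumr_const -cW -cards_draws; congr (_ *+ _).
    by apply: eq_card => T; rewrite !inE.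
  rewrite exchange_big /=.
  apply: (@le_trans _ _ (\sum_(E in tr W) 'C(m + m, m)%:R)).
    apply: ler_sum => _ /imsetP[E EA ->].
    by apply: expR_subsets_le => //; apply: subsetIr.
  by rewrite sumr_const -[leLHS]mulr_natl ler_wpM2r ?ler0n // ler_nat leB.
have exch (G : {set I} -> {set I} -> R) :
    \sum_(T : {set I} | #|T| == m)
       \sum_(W : {set I} | (T \subset W) && (#|W| == m + m)%N) G T W =
    \sum_(W : {set I} | #|W| == (m + m)%N)
       \sum_(T : {set I} | (T \subset W) && (#|T| == m)) G T W.
  rewrite (exchange_big_dep (fun W : {set I} => #|W| == (m + m)%N)) /=; last first.
    by move=> T W _ /andP[].
  apply: eq_bigr => W cW; apply: eq_bigl => T; by rewrite cW andbT andbC.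
have Np : 0 < N%:R :> R by rewrite ltr0n.
rewrite -(ler_pM2l Np) mulrCA.
apply: (@le_trans _ _ (\sum_(T : {set I} | #|T| == m)
   \sum_(W : {set I} | (T \subset W) && (#|W| == m + m)%N) H T W)).
  apply: (@le_trans _ _ (\sum_(T in Bad) N%:R * expR a)).
    by rewrite sumr_const -[leRHS]mulr_natl.
  apply: le_trans (ler_sum _ lower) _.
  rewrite [leRHS](bigID (mem Bad)) /=.
  have -> : \sum_(T in Bad) \sum_(W : {set I} | (T \subset W) && (#|W| == m + m)%N) H T W =
     \sum_(T : {set I} | (#|T| == m) && (T \in Bad))
       \sum_(W : {set I} | (T \subset W) && (#|W| == m + m)%N) H T W.
    by apply: eq_bigl => T; rewrite inE andbA andbb.
  by rewrite lerDl; apply: sumr_ge0 => T _; apply: sumr_ge0.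
rewrite exch; apply: (@le_trans _ _ (B%:R * \sum_(W : {set I} | #|W| == (m + m)%N)
     \sum_(T : {set I} | (T \subset W) && (#|T| == m)) 1)).
  by rewrite mulr_sumr; apply: ler_sum => W /eqP; apply: upper.
(* Counting the pairs from the side of [T] gives [N] for each training set, and this [N] cancels the
   one on the left. *)
rewrite -(exch (fun _ _ => 1)).
have -> : \sum_(T : {set I} | #|T| == m)
   \sum_(W : {set I} | (T \subset W) && (#|W| == m + m)%N) (1 : R) =
   \sum_(T : {set I} | #|T| == m) N%:R.
  apply: eq_bigr => T /eqP cT; rewrite sumr_const -(cN T cT); congr (_ *+ _).
  by apply: eq_card => W; rewrite !inE.
rewrite sumr_const -cI -card_draws.
have -> : #|(fun T : {set I} => #|T| == m) : pred _| = #|[set T : {set I} | #|T| == m]|.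
  by apply: eq_card => T; rewrite !inE.
by rewrite -(mulr_natr N%:R) mulrCA.
Qed.

(** * Error sets, realizability and empirical losses *)

Definition err_set {T : Type} {I : finType} (xs : I -> T) (ys : I -> bool)
    (f : T -> bool) : {set I} :=
  [set i | f (xs i) != ys i].

(** [F] may be infinite, but its error sets on the sample form a finite family; classical truth
    values make membership boolean. *)
Definition err_family {T : Type} {I : finType} (F : classical_sets.set (T -> bool))
    (xs : I -> T) (ys : I -> bool) : {set {set I}} :=
  [set E | `[< exists2 f, F f & E = err_set xs ys f >]].

Lemma err_familyP {T : Type} {I : finType} (F : classical_sets.set (T -> bool))
    (xs : I -> T) (ys : I -> bool) (E : {set I}) :
  E \in err_family F xs ys <-> exists2 f, F f & E = err_set xs ys f.
Proof. by rewrite inE; split => /asboolP. Qed.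

(* Realizability makes the labels a function of the features, so a shattered
   index set cannot contain two indices with the same feature. *)
Lemma card_shattered_err_family {T : choiceType} {I : finType}
    (F : classical_sets.set (T -> bool)) (xs : I -> T) (ys : I -> bool) (d : nat)
    (S : {set I}) :
  has_VCdim F d -> (exists2 g, F g & forall i, g (xs i) = ys i) ->
  fam_shatters (err_family F xs ys) S -> (#|S| <= d)%N.
Proof.
move=> [_ Fd] [g _ gy] /fam_shattersP H.
have shatS (B : {set I}) : B \subset S ->
    exists2 f, F f & forall i, i \in S -> (f (xs i) != ys i) = (i \in B).
  move=> /H[E /err_familyP[f Ff ->] EB]; exists f => // i iS.
  by rewrite -EB !inE iS andbT.
have inj : {in S &, injective xs}.
  move=> i j iS jS eqx; apply/eqP; apply: contraT => neq.
  have [|f _ fE] := shatS [set i]; first by rewrite sub1set.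
  have := fE i iS; have := fE j jS.
  by rewrite !inE eqxx (eq_sym j) (negPf neq) -!gy eqx => ->.
pose S' := [fset x in [seq xs i | i <- enum S]]%fset.
have cS' : #|` S'| = #|S|.
  rewrite card_fseq undup_id ?size_map -?cardE // map_inj_in_uniq ?enum_uniq //.
  by move=> i j; rewrite !mem_enum; apply: inj.
rewrite -cS'; apply: Fd => A sA.
(* To take the values prescribed by [A], [f] must err exactly where the label disagrees with [A]. *)
have [|f Ff fE] := shatS [set i in S | ys i != (xs i \in A)].
  by apply/subsetP => i; rewrite inE => /andP[].
exists f => // x; rewrite in_fset => /mapP[i]; rewrite mem_enum => iS ->.
have := fE i iS; rewrite inE iS /=.
by case: (f _); case: (ys i); case: (_ \in A).
Qed.

Lemma sq_lossE (R : realType) {T : Type} {n : nat} (xs : 'I_n -> T)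
    (ys : 'I_n -> bool) (f : T -> bool) (i : 'I_n) :
  sq_loss R xs ys f i = (i \in err_set xs ys f)%:R.
Proof.
rewrite /sq_loss inE; case: (f _); case: (ys i) => /=;
  by rewrite ?subrr ?subr0 ?sub0r ?sqrrN ?expr1n ?expr0n.
Qed.

Lemma sum_sq_loss (R : realType) {T : Type} {n : nat} (xs : 'I_n -> T)
    (ys : 'I_n -> bool) (f : T -> bool) (Z : {set 'I_n}) :
  \sum_(i in Z) sq_loss R xs ys f i = #|err_set xs ys f :&: Z|%:R.
Proof.
rewrite (eq_bigr (fun i => (i \in err_set xs ys f)%:R)); last first.
  by move=> i _; rewrite sq_lossE.
rewrite -natr_sum -sum1_card; congr (_%:R).
rewrite [RHS]big_mkcond [LHS]big_mkcond /=; apply: eq_bigr => i _.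
by rewrite in_setI andbC; case: (i \in Z) => //=; case: (i \in _).
Qed.

(** The realizing function has zero training loss, so a minimizer has zero training loss too. *)
Lemma minimizer_disjoint (R : realType) {T : Type} (u m : nat)
    (F : classical_sets.set (T -> bool)) (xs : 'I_(u + m) -> T)
    (ys : 'I_(u + m) -> bool) (Z : {set 'I_(u + m)}) (f : T -> bool) :
  (0 < m)%N -> (exists2 g, F g & forall i, g (xs i) = ys i) ->
  is_minimizer F (fun f => train_mean Z (sq_loss R xs ys f)) f ->
  [disjoint err_set xs ys f & ~: Z].
Proof.
move=> m0 [g Fg gy] [_ /(_ g Fg)]; rewrite /train_mean !sum_sq_loss.
have -> : err_set xs ys g = set0 by apply/setP => i; rewrite !inE gy eqxx.
rewrite set0I cards0 mulr0 pmulr_rle0 ?invr_gt0 ?ltr0n // lern0 cards_eq0.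
by rewrite setI_eq0.
Qed.

(** * Explicit constants, and the passage from training sets to splits *)

Lemma sum_bin_le_expR (R : realType) (m d : nat) : (0 < d)%N -> (d <= m)%N ->
  (\sum_(i < d.+1) 'C(m + m, i))%:R <= expR (2 * (d%:R * ln (m%:R * expR 1 / d%:R))) :> R.
Proof.
move=> d0 dm; apply: le_trans (sum_bin_le R _ _ d0 (leq_trans dm (leq_addr _ _))) _.
have d0R : 0 < d%:R :> R by rewrite ltr0n.
have e2 : 2 <= expR 1 :> R by apply: le_trans (expR_ge1Dx _); lra.
set r := m%:R * expR 1 / d%:R.
(* Since [r >= 2], the factor 2 coming from the doubled sample is absorbed by [2 * r <= r ^+ 2];
   this puts the 2 in the exponent. *)
have r2 : 2 <= r.
  by rewrite ler_pdivlMr // [leRHS]mulrC; apply: ler_pM; rewrite ?ler_nat ?ler0n.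
have r0 : 0 < r by lra.
rewrite [2 * _]mulrCA expRM_natl expRM_natl lnK ?posrE //.
apply: lerXn2r; rewrite ?nnegrE ?exprn_ge0 ?mulr_ge0 ?invr_ge0 ?expR_ge0 ?ler0n ?(ltW r0) //.
have -> : expR 1 * ((m + m)%:R / d%:R) = 2 * r.
  by rewrite natrD /r; field; rewrite gt_eqF.
by rewrite expr2 ler_wpM2r // ltW.
Qed.

End FiniteSets.

Theorem theoremV1 (R : realType) :
  exists c0 c1 : R, [/\ 0 < c0, 0 < c1 &
  forall (d' : nat) (X : set 'rV[R]_d') (F : set (X -> bool)) (d u m : nat)
    (xs : 'I_(u + m) -> X) (ys : 'I_(u + m) -> bool)
    (fhat : {set 'I_(u + m)} -> (X -> bool)),
    has_VCdim F d -> (2 <= d)%N -> (d <= m)%N -> (m <= u)%N ->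
    (exists2 fstar, F fstar & forall i, fstar (xs i) = ys i) ->
    (forall Z, Z \in splits u m ->
       is_minimizer F (fun f => train_mean Z (sq_loss R xs ys f)) (fhat Z)) ->
    forall t : R, 0 < t ->
      1 - expR (- t) <=
        unif_prob R (splits u m) (fun Z : {set 'I_(u + m)} =>
          test_mean Z (sq_loss R xs ys (fhat Z)) <=
            c0 * (d%:R * ln (m%:R * expR 1 / d%:R) / m%:R) + c1 * (t / m%:R))].
Proof.
(* The exponent [eps * m / 2] must equal [2 * L + t]: [2 * L] pays for the number of traces and [t]
   remains. Hence the constants 4 and 2. *)
exists 4, 2; split => // d' X F d u m xs ys fhat Fd d2 dm mu real minf t t0.
set eps := 4 * _ + _.
have d0 : (0 < d)%N by lia.
have m0 : (0 < m)%N by lia.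
have u0 : (0 < u)%N by lia.
have m0R : 0 < m%:R :> R by rewrite ltr0n.
have u0R : 0 < u%:R :> R by rewrite ltr0n.
pose L : R := d%:R * ln (m%:R * expR 1 / d%:R).
pose P (Z : {set 'I_(u + m)}) := test_mean Z (sq_loss R xs ys (fhat Z)) <= eps.
pose A := err_family F xs ys.
pose a : R := 2 * L + t.
have cI : #|'I_(u + m)| = (u + m)%N by rewrite card_ord.
have leB (W : {set 'I_(u + m)}) : #|W| = (m + m)%N ->
    (#|[set E :&: W | E in A]%SET| <= \sum_(i < d.+1) 'C(m + m, i))%N.
  move=> <-; apply: leq_card_traces => S.
  exact: card_shattered_err_family Fd real.
have := card_bad_training_sets R _ _ u m _ a cI m0 mu leB.
set Bad := finset _ => bound.
pose BadZ := [set Z in splits u m | ~~ P Z]%SET.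
(* Complementation sends each failing test set injectively to a bad training set. *)
have leBad : (#|BadZ| <= #|Bad|)%N.
  rewrite -(card_imset (mem BadZ) (can_inj (@finset.setCK _))).
  apply/subset_leq_card/fintype.subsetP => _ /imsetP[Z ZB ->].
  move: ZB; rewrite !inE => /andP[cZ nP].
  have sZ : Z \in splits u m by rewrite inE.
  have dis := minimizer_disjoint R u m F xs ys Z _ m0 real (minf Z sZ).
  apply/andP; split; first by have := cardsC Z; rewrite (eqP cZ) card_ord => /addnI ->.
  apply/exists_inP; exists (err_set xs ys (fhat Z)).
    by apply/err_familyP; exists (fhat Z) => //; case: (minf Z sZ).
  rewrite dis /=; move: nP; rewrite -ltNge /test_mean sum_sq_loss.
  (* All errors of the minimizer fall in [Z], so the test loss counts its whole error set. *)
  have -> : finset.setI (err_set xs ys (fhat Z)) Z = err_set xs ys (fhat Z).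
    by apply/finset.setIidPl; move: dis; rewrite finset.disjoints_subset finset.setCK.
  move: (_%:R) => e le_e.
  have -> : a = eps * m%:R / 2.
    by rewrite /a /eps /L; field; rewrite !gt_eqF ?ltr0n.
  rewrite ler_pM2r ?invr_gt0 // mulrAC ler_pM2r // mulrC; exact: ltW.
have cS : #|splits u m| = 'C(u + m, m).
  by rewrite card_draws cI -[RHS]bin_sub ?leq_addl // addnK.
have c0 : 0 < 'C(u + m, m)%:R :> R by rewrite ltr0n bin_gt0 leq_addl.
rewrite /unif_prob cS ler_pdivlMr //.
have /(congr1 (fun n => n%:R : R)) :
    (#|[set Z in splits u m | P Z]%SET| + #|BadZ| = #|splits u m|)%N.
  rewrite -(cardsID [set Z | P Z]%SET (splits u m)); congr (_ + _)%N;
    by apply: eq_card => Z; rewrite !inE // andbC.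
rewrite natrD cS => cE.
suff : #|BadZ|%:R <= expR (- t) * 'C(u + m, m)%:R by rewrite /P in cE *; lra.
rewrite expRN ler_pdivlMl ?expR_gt0 // mulrC.
rewrite -(ler_pM2r (expR_gt0 (2 * L))) -mulrA -expRD addrC -/a.
apply: (@le_trans _ _ (#|Bad|%:R * expR a)).
  by rewrite ler_wpM2r ?expR_ge0 ?ler_nat.
apply: le_trans bound _; rewrite mulrC ler_wpM2l ?ler0n //.
exact: sum_bin_le_expR.
Qed.
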